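(* Let $n\ge 1$ be an integer. For $i=1,\dots,n$, let $x_i\ge 0$ be real numbers, and let $\alpha_i>0$ be real numbers satisfying $\sum_{i=1}^n \alpha_i = 1$. Then $$\prod_{i=1}^n x_i^{\alpha_i} \le \sum_{i=1}^n \alpha_i x_i - \sum_{i=1}^n \alpha_i \left(x_i^{1/2} - \sum_{k=1}^n \alpha_k x_k^{1/2}\right)^2.$$
   Context: All powers are the usual nonnegative real powers of nonnegative real numbers, with $0^{a}=0$ for $a>0$. *)

(* Defs.v *)
From mathcomp Require Import all_boot all_order all_algebra.
From mathcomp Require Import reals exp.

(* Main.v *)
Require Import Defs.
From mathcomp Require Import all_boot all_order all_algebra.
From mathcomp Require Import reals sequences exp.
From mathcomp Require Import ring.

(** Expanding the square, the right-hand side equals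
    [(\sum_i alpha i * sqrt (x i)) ^+ 2], so the claim is the square of the
    weighted AM-GM inequality for the numbers [sqrt (x i)]. With [M] their
    weighted mean, AM-GM follows by multiplying the bounds
    [y i <= M * expR (y i / M - 1)] raised to the powers [alpha i]: the
    exponents add up to [0]. *)

Import Order.TTheory GRing.Theory Num.Theory.
Local Open Scope ring_scope.

Lemma powR_prod_sum (R : realType) (I : Type) (r : seq I) (M : R) (a : I -> R) :
  0 < M -> \prod_(i <- r) M `^ a i = M `^ (\sum_(i <- r) a i).
Proof.
move=> M0; elim: r => [|i r IH]; first by rewrite !big_nil powRr0.
by rewrite !big_cons IH powRD// (gt_eqF M0) implybT.
Qed.

Lemma weighted_AMGM (R : realType) (I : finType) (y a : I -> R) :
  (forall i, 0 <= y i) -> (forall i, 0 < a i) -> \sum_i a i = 1 ->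
  \prod_i (y i `^ a i) <= \sum_i a i * y i.
Proof.
move=> y0 a0 a1; set M := \sum_i a i * y i.
have ay0 i : true -> 0 <= a i * y i by move=> _; rewrite mulr_ge0// ltW.
have : 0 <= M by apply: sumr_ge0.
rewrite le_eqVlt => /predU1P[M0|M0].
  (* A zero mean is treated apart because the main argument divides by [M]. The weights sum to 1, so
     an index [i] exists; its term in a zero sum of nonnegative terms vanishes, and [a i > 0] forces
     [y i = 0], which kills the product. *)
  have [i _ | noI] := pickP (fun _ : I => true); last first.
    by case/eqP: (oner_neq0 R); rewrite -a1 big_pred0.
  have /eqP : a i * y i = 0 by apply: (psumr_eq0P ay0 (esym M0)).
  rewrite mulf_eq0 gt_eqF//= => /eqP yi0.
  by rewrite (bigD1 i)//= yi0 powR0 ?gt_eqF// mul0r -M0.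
have bound i : y i `^ a i <= M `^ a i * expR (a i * (y i / M - 1)).
  (* This is [1 + t <= expR t] at [t = y i / M - 1]. *)
  have yE : y i <= M * expR (y i / M - 1).
    rewrite mulrC -ler_pdivrMr//; apply: le_trans (expR_ge1Dx _).
    by rewrite addrCA subrr addr0.
  rewrite [a i * (_ - _)]mulrC expRM -powRM ?expR_ge0 ?(ltW M0)//.
  by rewrite ge0_ler_powR ?nnegrE ?mulr_ge0 ?expR_ge0// ltW.
apply: le_trans (_ : _ <= \prod_i (M `^ a i * expR (a i * (y i / M - 1)))) _.
  by apply: ler_prod => i _; rewrite powR_ge0 bound.
rewrite big_split/= powR_prod_sum// a1 powRr1 ?(ltW M0)// -expR_sum.
suff -> : \sum_i a i * (y i / M - 1) = 0 by rewrite expR0 mulr1.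
under eq_bigr do rewrite mulrBr mulr1 mulrA.
by rewrite sumrB -mulr_suml a1 divff ?subrr ?gt_eqF.
Qed.

(** After expansion, the factors [M *+ 2] and [M ^+ 2] leave the sums; what remains is [M] and total
    weight 1, so the correction is [M * (M *+ 2) - M ^+ 2], that is [M ^+ 2]. *)
Lemma weighted_variance (R : comPzRingType) (I : finType) (y a : I -> R) :
  \sum_i a i = 1 ->
  \sum_i a i * (y i - \sum_k a k * y k) ^+ 2 =
  \sum_i a i * y i ^+ 2 - (\sum_i a i * y i) ^+ 2.
Proof.
move=> a1; set M := \sum_k a k * y k.
under eq_bigr => i _.
  have -> : a i * (y i - M) ^+ 2 =
    a i * y i ^+ 2 - (a i * y i * (M *+ 2) - a i * M ^+ 2) by ring.
  over.
by rewrite !sumrB -!mulr_suml a1 -/M; ring.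
Qed.

Theorem theorem0p1 (R : realType) (n : nat) (hn : (1 <= n)%N)
    (x alpha : 'I_n -> R)
    (hx : forall i, 0 <= x i)
    (halpha : forall i, 0 < alpha i)
    (hsum : \sum_(i < n) alpha i = 1) :
  \prod_(i < n) (x i `^ alpha i) <=
    \sum_(i < n) (alpha i * x i) -
    \sum_(i < n)
      (alpha i *
       (x i `^ (1 / 2) - \sum_(k < n) (alpha k * x k `^ (1 / 2))) ^+ 2).
Proof.
pose s i := x i `^ (1 / 2).
have sK i : s i ^+ 2 = x i.
  by rewrite /s div1r powR12_sqrt// sqr_sqrtr.
rewrite (weighted_variance _ _ s)//.
under [X in _ - (X - _)]eq_bigr do rewrite sK.
rewrite subKr.
under eq_bigr => i _ do rewrite -(sK i) expr2 powRM ?powR_ge0//.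
rewrite big_split/= -expr2 lerXn2r ?nnegrE//=.
- by apply: prodr_ge0 => i _; apply: powR_ge0.
- by apply: sumr_ge0 => i _; rewrite mulr_ge0 ?powR_ge0 ?ltW.
- by apply: weighted_AMGM => // i; apply: powR_ge0.
Qed.
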